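(* Let $G$ be a rectifiable space. If $G$ has a $\sigma$-point-discrete closed $k$-network, then $G$ contains no closed copy of $S_{\omega_1}$.
   Context: All spaces are assumed to be $T_1$ and regular. A topological space $G$ is a rectifiable space if there are a surjective homeomorphism $\varphi: G\times G\to G\times G$ and an element $e\in G$ such that $\pi_1\circ\varphi=\pi_1$ and $\varphi(x,x)=(x,e)$ for every $x\in G$, where $\pi_1:G\times G\to G$ is the projection to the first coordinate. A family $\mathscr{P}$ of subsets of a space $X$ is a $k$-network if whenever $K$ is a compact subset of $X$ and $K\subset U$ with $U$ open in $X$, there is a finite subfamily $\mathscr{P}'\subset\mathscr{P}$ with $K\subset\bigcup\mathscr{P}'\subset U$. A family $\{B_\alpha:\alpha\in H\}$ of subsets of $X$ is point-discrete if $\{x_\alpha:\alpha\in H\}$ is closed and discrete in $X$ whenever $x_\alpha\in B_\alpha$ for each $\alpha\in H$. A $\sigma$-point-discrete closed $k$-network is a $k$-network consisting of closed sets that is a union of countably many point-discrete families. $S_{\omega_1}$ is the space obtained from the topological sum of $\omega_1$ many (non-trivial) convergent sequences, each taken with its limit point, by identifying all the limit points to one point (quotient topology). A closed copy of $S_{\omega_1}$ in $G$ is a closed subspace of $G$ homeomorphic to $S_{\omega_1}$. *)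

(* Defs.v *)
From HB Require Import structures.
From mathcomp Require Import all_boot all_order all_algebra.
From mathcomp Require Import all_classical.
From mathcomp Require Export wochoice.
From mathcomp Require Import topology wedge_sigT.

Set Implicit Arguments.
Unset Strict Implicit.
Unset Printing Implicit Defensive.

Local Open Scope classical_set_scope.

Definition homeomorphism (X Y : topologicalType) (f : X -> Y) : Prop :=
  continuous f /\
  exists g : Y -> X, [/\ continuous g, cancel f g & cancel g f].

Definition rectifiable (G : topologicalType) : Prop :=
  exists (phi : G * G -> G * G) (e : G),
    [/\ homeomorphism phi,
        forall p, (phi p).1 = p.1
      & forall x, phi (x, x) = (x, e)].

Definition k_network (X : topologicalType) (P : set (set X)) : Prop :=
  forall K U : set X, compact K -> open U -> K `<=` U ->
  exists P' : set (set X),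
    [/\ finite_set P', P' `<=` P,
        K `<=` \bigcup_(B in P') B & \bigcup_(B in P') B `<=` U].

(* [isolated A = A] says that [A] is discrete in its subspace topology. *)
Definition closed_discrete (X : topologicalType) (A : set X) : Prop :=
  closed A /\ isolated A = A.

(* Points are chosen from the nonempty members of [F] only: if they had to be
   chosen from every member, any family containing the empty set would be
   vacuously point-discrete. *)
Definition point_discrete (X : topologicalType) (F : set (set X)) : Prop :=
  forall x : set X -> X,
    (forall B, F B -> B !=set0 -> B (x B)) ->
    closed_discrete [set x B | B in [set B | F B /\ B !=set0]].

Definition has_sigma_point_discrete_closed_k_network
    (X : topologicalType) : Prop :=
  exists P : nat -> set (set X),
    [/\ forall n, point_discrete (P n),
        forall n B, P n B -> closed B
      & k_network (\bigcup_n P n)].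

(* [R] (a reflexive order) well-orders [I] in order type omega_1. *)
Definition order_type_omega1 (I : choiceType) (R : rel I) : Prop :=
  [/\ well_order R,
      ~ countable [set: I]
    & forall i : I, countable [set j | R j i /\ j <> i]].

(* A convergent sequence with its limit point is the one-point compactification
   of the discrete space [nat], [None] being the limit. [wedge] is the quotient
   of the topological sum that identifies the base points. *)
Definition sequential_fan (I : choiceType) : topologicalType :=
  wedge (fun _ : I => None : one_point_compactification nat).

Definition contains_closed_copy (X S : topologicalType) : Prop :=
  exists A : set X, closed A /\ exists f : S -> set_type A, homeomorphism f.

(* Such an order exists, so quantifying over all of them is not vacuous. *)
Lemma order_type_omega1_exists :
  exists (I : choiceType) (R : rel I), order_type_omega1 R.
Proof.
have [R woR] := well_ordering_principle (set nat).
have /wo_chain_antisymmetric Ranti : wo_chain R predT by exact: withinW.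
pose down (x : set nat) := [set y | R y x /\ y <> x].
pose P := [pred x | `[< countable (down x) >]].
pose I : choiceType := {x : set nat | P x}.
have Rmin (A : pred (set nat)) a : A a ->
    exists2 m, A m & forall y, A y -> R m y.
  move=> Aa; have [|m [[Am lm] _]] := woR A; first by exists a.
  by exists m => // y; exact: lm.
exists I, (fun a b => R (val a) (val b)); split.
- apply: antisymmetric_well_order.
    by move=> a b Rab; apply: val_inj; apply: Ranti.
  move=> A [a Aa].
  have [|z /asboolP[b [bA <-]] bmin] :=
    Rmin [pred x | `[< exists b : I, b \in A /\ val b = x >]] (val a).
    by apply/asboolP; exists a.
  by exists b; split=> // c cA; apply: bmin; apply/asboolP; exists c.
- move=> cI.
  have cP : countable [set x : set nat | P x].
    apply: (@sub_countable _ _ _ [set: I]) cI.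
    have -> : [set x : set nat | P x] = range (val : I -> set nat).
      rewrite eqEsubset; split=> x /=; last by case=> -[y Py] _ <-.
      by move=> Px; exists (exist _ x Px : I).
    exact: card_image_le.
  have [[w nPw]|allP] := pselect (exists w : set nat, ~~ P w).
    have [m /asboolP nPm mmin] := Rmin [pred x | ~~ P x] w nPw.
    apply: nPm; apply: sub_countable cP.
    apply: subset_card_le => y /= [Rym nym].
    apply/negPn/negP => nPy; apply: nym.
    by apply: Ranti => //; rewrite Rym mmin.
  have cT : countable [set: set nat].
    apply: sub_countable cP; apply: subset_card_le => x _ /=.
    by apply/negPn/negP => nPx; apply: allP; exists x.
  have /countable_injP[f finj] := cT.
  pose D := [set n | exists B : set nat, f B = n /\ ~ B n].
  have nD : ~ D (f D).
    move=> H; case: (H) => B [fB]; have -> : B = D by apply: finj; rewrite ?inE.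
    exact.
  by apply: (nD); exists D; split.
- move=> i; have /asboolP cd := valP i.
  apply: (@sub_countable _ _ _ (down (val i))); last exact: cd.
  apply: (@card_le_trans _ _ _ (val @^-1` down (val i))).
    by apply: subset_card_le => j /= [Rji nji]; split=> // /val_inj.
  by apply: card_ge_preimage => ? ? _ _; exact: val_inj.
Qed.

(* Main.v *)
Require Import Defs.
From mathcomp Require Import all_boot all_order all_algebra.
From mathcomp Require Import all_classical.
From mathcomp Require Import topology wedge_sigT.

Set Implicit Arguments.
Unset Strict Implicit.
Unset Printing Implicit Defensive.

(** A rectification of [G] yields, for every point [v], a continuous family of
maps [h (z, _) : G -> G] with [h (z, v) = z], with left inverses [g (z, _)] that
are again jointly continuous ([rectifiable_translations]).  Suppose that a
closed fan with vertex [v] and rays indexed by an uncountable [I] sits in [G].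
Take one of its rays, a sequence [z k] converging to [v], and let [Z] consist of
[v] and the [z k].  Moving the fan by the maps [h (z k, _)] puts a copy of the
fan at every [z k].

Let [P n] be the point-discrete layers of the closed [k]-network.  Say that a
member [B] is good if it contains [z k] for infinitely many [k].  Infinitely
many good members of one [P n] would let us select from them points [z k] with
[k] unbounded, so that the selected set, which is closed and discrete, would
accumulate at [v]; hence each [P n] has finitely many good members
([point_discrete_finite_frequent]), and the good members are countably many.

The translates by [Z] of the ray [a] form a compact set.  If finitely many
closed sets cover it, then near each [z k], hence for infinitely many [k] with
the same set, one of them contains both [z k] and a point of a translate of the
ray [a] that lies off [Z] ([cover_frequent]): it is good and meets the ray [a].

Now diagonalize.  A good [B] that meets infinitely many rays is given a
point [y B] in it, on a translate of a ray that no other such [B] uses.  Points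
of the original fan on distinct rays form a closed set all of whose subsets are
closed; since [Z] is compact this survives translation by varying points of [Z]
([closed_translates]), so that the [y B] form a closed set.  Off [Z], a point
lies on translates of countably many rays only, because [Z] is countable and
each [h (z, _)] is injective.  So for all but countably many [a] the complement
of the [y B] is a neighbourhood of the translates of the ray [a], and the
[k]-network provides a good [B] inside it that meets the ray [a]; this [B]
contains no [y C], hence meets finitely many rays.  There are countably many
such [B], and together they meet countably many rays, against the
uncountability of [I]. *)

Local Open Scope classical_set_scope.

(** * Choosing from infinite sets *)

Lemma infinite_nat_unbounded (A : set nat) (n : nat) :
  infinite_set A -> exists2 k, A k & (n <= k)%N.
Proof.
move=> Ainf; apply: contrapT => nA; apply: Ainf.
apply: (@sub_finite_set _ _ `I_n) => [k Ak /=|]; last exact: finite_II.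
by rewrite ltnNge; apply/negP => nk; apply: nA; exists k.
Qed.

Lemma infinite_set_notin (T : eqType) (A : set T) (s : seq T) :
  infinite_set A -> exists2 a, A a & a \notin s.
Proof.
move=> Ainf; apply: contrapT => nA; apply: Ainf.
apply: sub_finite_set (finite_seq s) => a Aa /=.
by apply: contrapT => /negP sa; apply: nA; exists a.
Qed.

(** A greedy choice works: at stage [n] only finitely many values are taken. *)
Lemma nat_distinct_representatives (T : eqType) (A : nat -> set T) :
  (forall n, infinite_set (A n)) ->
  exists a : nat -> T, (forall n, A n (a n)) /\ injective a.
Proof.
move=> Ainf.
have /choice[next nextP] : forall ns : nat * seq T,
    exists a, A ns.1 a /\ a \notin ns.2.
  by move=> [n s]; have [a ? ?] := infinite_set_notin s (Ainf n); exists a.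
(* [s n] lists the representatives [a 0, ..., a n.-1] already chosen. *)
pose s := fix s n := if n is k.+1 then next (k, s k) :: s k else [::].
pose a n := next (n, s n).
have as_ m n : (m < n)%N -> a m \in s n.
  elim: n => // n IHn; rewrite ltnS leq_eqVlt => /predU1P[->|/IHn mn].
    by rewrite inE eqxx.
  by rewrite inE mn orbT.
exists a; split => [n|m n]; first by have [] := nextP (n, s n).
have neq m' n' : (m' < n')%N -> a m' <> a n'.
  move=> mn amn; have [_] := nextP (n', s n').
  by rewrite /= -/(a n') -amn as_.
by case: (ltngtP m n) => // /neq // nm amn; case: nm.
Qed.

Lemma countable_distinct_representatives (J : Type) (I : choiceType)
    (E : set J) (T : J -> set I) :
  countable E -> (forall j, E j -> infinite_set (T j)) -> E !=set0 ->
  exists a : J -> I, (forall j, E j -> T j (a j)) /\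
    (forall i j, E i -> E j -> a i = a j -> i = j).
Proof.
move=> /countable_injP[c cinj] Tinf [j0 Ej0].
(* [d] is a left inverse on [E] of the injection [c] into [nat]; off the image
   of [c] it takes the value [j0], where the assumption on [T] still holds. *)
have /choice[d dP] : forall n, exists j, E j /\
    (forall i, E i -> c i = n -> j = i).
  move=> n; have [[j [Ej cj]]|nj] := pselect (exists j, E j /\ c j = n).
    by exists j; split=> // i Ei ci; apply: cinj; rewrite ?inE// ci.
  by exists j0; split=> // i Ei ci; case: nj; exists i.
have dc j : E j -> d (c j) = j by move=> Ej; apply: (dP _).2.
have [a [aT ainj]] := nat_distinct_representatives
  (fun n => Tinf _ (dP n).1).
exists (a \o c); split => [j Ej|i j Ei Ej /ainj cij] /=.
  by rewrite -{1}(dc j Ej); exact: aT.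
by apply: cinj; rewrite ?inE.
Qed.

Lemma finite_fiber_infinite (T : choiceType) (A : set T) (c : nat -> T) :
  finite_set A -> (forall k, A (c k)) ->
  exists2 t, A t & infinite_set [set k | c k = t].
Proof.
move=> Afin cA; apply: contrapT => nA; apply: infinite_nat.
rewrite (_ : setT = \bigcup_(t in A) [set k | c k = t]); last first.
  by apply/seteqP; split => // k _; exists (c k).
apply: bigcup_finite => // t At; apply: contrapT => tinf.
by apply: nA; exists t.
Qed.

(** * The fan and its closed copies *)

Local Notation opc_nat := (one_point_compactification nat).

(** The discrete neighbourhoods of the points [k] each give a bound
[k < N] that holds for [N] large; compactness makes the bounds uniform. *)
Lemma compact_nat_bounded (K : set nat) :
  compact K -> \forall N \near \oo, K `<=` [set k | (k < N)%N].
Proof.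
move=> /compact_near_coveringP Kcov.
apply: (Kcov nat \oo (fun N k => (k < N)%N)) => k _.
exists ([set k], [set N | (k < N)%N]); last by move=> [i N] /= [-> ].
by split; [exact: discrete_set1 | exists k.+1].
Qed.

Lemma opc_nat_cvg : (Some : nat -> opc_nat) @ \oo --> (None : opc_nat).
Proof.
move=> V [K [/compact_nat_bounded Kbd _] KV].
have [N _ KN] := Kbd; exists N => // n Nn; apply: KV; left; exists n => // Kn.
by have := KN n Nn n Kn; rewrite /= ltnn.
Qed.

Lemma opc_nat_closed_None (C : set opc_nat) : C None -> closed C.
Proof.
move=> CN; rewrite -openC openE => -[n nC|//].
suff: nbhs n (Some @^-1` ~` C) by [].
by apply: (filterS _ (discrete_set1 n)) => _ ->.
Qed.

Lemma opc_nat_closed_sub1 (C : set opc_nat) n :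
  C `<=` [set Some n] -> closed C.
Proof.
move=> Cn; rewrite -openC openE => -[k kC|nC].
  suff: nbhs k (Some @^-1` ~` C) by [].
  by apply: (filterS _ (discrete_set1 k)) => _ ->.
exists [set n].
  by split; [exact: compact_set1 | exact: discrete_closed].
by move=> _ [[k nk <-] /Cn[]|->].
Qed.

(** The images in [G] of the rays of a closed copy of the sequential fan, each
parametrized together with its limit.  The rays meet in the vertex only, and
[fan_closed] is the quotient topology, read off on closed sets: it says both
that the copy is closed in [G] and that it carries the topology of the fan. *)
Record fan (G : topologicalType) (I : choiceType)
    (ray : I -> opc_nat -> G) : Prop := {
  ray_continuous : forall a, continuous (ray a);
  ray_None : forall a b, ray a None = ray b None;
  ray_inj : forall a b n o, ray a (Some n) = ray b o -> a = b /\ o = Some n;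
  fan_closed : forall C, C `<=` \bigcup_a range (ray a) ->
    (forall a, closed (ray a @^-1` C)) -> closed C }.

(** The labelling of the points off the vertex by their ray and their index is
compatible with the identification of the vertices, so it descends to the
wedge, where it recovers the ray and the index. *)
Lemma wedge_lift_Some_inj (I : choiceType) (a b : I) n (o : opc_nat) :
  @wedge_lift I (fun=> opc_nat) (fun=> None) a (Some n) =
    @wedge_lift I (fun=> opc_nat) (fun=> None) b o ->
  a = b /\ o = Some n.
Proof.
pose label (i : I) (x : opc_nat) := omap (pair i) x.
move/(congr1 (wedge_fun label)); rewrite !wedge_lift_funE//.
by case: o => // m [<- <-].
Qed.

Lemma closed_copy_fan (G : topologicalType) (I : choiceType) :
  contains_closed_copy G (sequential_fan I) ->
  exists ray : I -> opc_nat -> G, fan ray.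
Proof.
move=> [A [Acl [f [fcont [g [gcont fK gK]]]]]].
pose lift a : opc_nat -> sequential_fan I :=
  @wedge_lift I (fun=> opc_nat) (fun=> None) a.
pose j (s : sequential_fan I) : G := set_val (f s).
have jcont : continuous j.
  by move=> s; apply: continuous_comp; [exact: fcont|exact: initial_continuous].
have jinj : injective j by move=> s t /val_inj; exact: (can_inj fK).
have lcont a : continuous (lift a) by exact: wedge_lift_continuous.
exists (fun a => j \o lift a); split.
- by move=> a x; apply: continuous_comp; [exact: lcont|exact: jcont].
- by move=> a b; apply: (congr1 j);
  exact: (@wedge_liftE I (fun=> opc_nat) (fun=> None) b None a None).
- by move=> a b n o /jinj; exact: wedge_lift_Some_inj.
move=> C Csub Ccl.
have : closed (g @^-1` (j @^-1` C)).
  move/continuous_closedP: gcont; apply.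
  rewrite -openC; apply/wedge_openP => a.
  by rewrite preimage_setC openC; exact: Ccl.
rewrite -openC => -[W Wo WC].
suff -> : C = A `&` ~` W by apply: closedI => //; exact: open_closedC.
have CA s : C (j s) <-> ~ W (j s).
  suff -> : W (j s) = ~ C (j s) by split=> [c|/contrapT//]; apply.
  by rewrite -{2}(fK s); exact: (congr1 (fun U => U (f s)) WC).
apply/seteqP; split => x.
  move=> Cx; have [a _ [o _ ox]] := Csub x Cx; rewrite -ox in Cx *.
  by split; [exact: set_valP|exact/CA].
move=> [Ax nWx].
have xE : j (g (exist _ x (mem_set Ax))) = x by rewrite /j gK.
by rewrite -xE; apply/CA; rewrite xE.
Qed.

(** Points on distinct rays form a closed set, because on each ray there is at
most one of them.  As this applies to subsets, such a set is discrete too. *)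
Lemma fan_transversal_closed (G : topologicalType) (I : choiceType)
    (ray : I -> opc_nat -> G) (J : Type) (D : set J) (a : J -> I)
    (m : J -> nat) :
  fan ray -> (forall i j, D i -> D j -> a i = a j -> i = j) ->
  closed [set ray (a j) (Some (m j)) | j in D].
Proof.
move=> rayF ainj; apply: (fan_closed rayF) => [_ [j Dj <-]|b].
  by exists (a j) => //; exists (Some (m j)).
have [[j [Dj aj]]|nb] := pselect (exists j, D j /\ a j = b).
  apply: (@opc_nat_closed_sub1 _ (m j)) => o [i Di] /(ray_inj rayF)[ib ->].
  by rewrite (ainj i j)// ib.
rewrite (_ : _ @^-1` _ = set0); first exact: closed0.
apply/seteqP; split=> // o [i Di] /(ray_inj rayF)[ib _].
by case: nb; exists i.
Qed.

(** The vertex remains, and in a fan any set through the vertex is closed; this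
makes [ray a (Some k)] isolated in its ray. *)
Lemma fan_ray_remove_closed (G : topologicalType) (I : choiceType)
    (ray : I -> opc_nat -> G) (a : I) (k : nat) :
  fan ray -> closed (range (ray a) `\ ray a (Some k)).
Proof.
move=> rayF; apply: (fan_closed rayF) => [_ [[o _ <-] _]|b].
  by exists a => //; exists o.
apply: opc_nat_closed_None; split; first by exists None => //; exact: ray_None.
by move=> /esym/(ray_inj rayF)[].
Qed.

(** * Translations in a rectifiable space *)

(** Write the rectification as [(x, y) |-> (x, q (x, y))] with inverse
[(x, y) |-> (x, p (x, y))], so that [q (x, x) = e] and [p (x, e) = x].  Then
[q (v, _)] moves [v] to [e] and [p (z, _)] moves [e] to [z]; [h (z, _)] is the
composite, undone by [g (z, _)], which is [q (z, _)] followed by [p (v, _)]. *)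
Lemma rectifiable_translations (G : topologicalType) (v : G) :
  rectifiable G -> exists h g : G * G -> G,
    [/\ continuous h, continuous g, forall z, h (z, v) = z
      & forall z x, g (z, h (z, x)) = x].
Proof.
move=> [phi [e [[phic [psi [psic phiK psiK]]] phi1 phixx]]].
have phiE z y : (z, (phi (z, y)).2) = phi (z, y).
  by rewrite [RHS]surjective_pairing phi1.
have psi1 p : (psi p).1 = p.1 by rewrite -[in RHS](psiK p) phi1.
have psiE z y : (z, (psi (z, y)).2) = psi (z, y).
  by rewrite [RHS]surjective_pairing psi1.
have c2 (k : G * G -> G * G) : continuous k -> continuous (snd \o k).
  by move=> kc p; apply: continuous_comp; [exact: kc|exact: cvg_snd].
have cvar (k l : G * G -> G * G) : continuous k -> continuous l ->
    continuous (fun p => (k (p.1, (l (v, p.2)).2)).2).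
  move=> kc lc p.
  apply: (@continuous_comp _ _ _ (fun p => (p.1, (l (v, p.2)).2)) (snd \o k));
    last exact: c2.
  apply: cvg_pair; first exact: cvg_fst.
  apply: (@continuous_comp _ _ _ (fun p => (v, p.2)) (snd \o l));
    last exact: c2.
  by apply: cvg_pair; [exact: cvg_cst|exact: cvg_snd].
have cvar' (k l : G * G -> G * G) : continuous k -> continuous l ->
    continuous (fun p => (k (v, (l p).2)).2).
  move=> kc lc p.
  apply: (@continuous_comp _ _ _ (fun p => (v, (l p).2)) (snd \o k));
    last exact: c2.
  by apply: cvg_pair; [exact: cvg_cst|exact: c2].
exists (fun p => (psi (p.1, (phi (v, p.2)).2)).2),
  (fun p => (psi (v, (phi p).2)).2); split.
- exact: (cvar psi phi).
- exact: (cvar' psi phi).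
- by move=> z /=; rewrite phixx/= -(phixx z) phiK.
- by move=> z x /=; rewrite psiE psiK/= phiE phiK.
Qed.

(** Given a point [y] that is none of the translates [h (z j, x j)] and a point
[t] of [Z], a translate close to [y] by a [z j] close to [t] has its [x j] close
to [g (t, y)].  The only such [x j] is [g (t, y)] itself, as the other ones form
a closed set; that leaves at most one translate, and it can be avoided.
Compactness of [Z] yields a neighbourhood of [y] that serves for all [t]. *)
Lemma closed_translates (G : topologicalType) (J : Type) (h g : G * G -> G)
    (Z : set G) (E : set J) (z x : J -> G) :
  accessible_space G -> continuous g ->
  (forall t y, g (t, h (t, y)) = y) ->
  compact Z -> (forall j, E j -> Z (z j)) ->
  (forall i j, E i -> E j -> x i = x j -> i = j) ->
  (forall D, D `<=` E -> closed (x @` D)) ->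
  closed [set h (z j, x j) | j in E].
Proof.
move=> T1 gc gK Zc EZ xinj xcl.
rewrite -openC openE => y Yy; rewrite /interior.
have /compact_near_coveringP Zcov := Zc.
suff : \forall y' \near y,
    Z `<=` (fun t => forall j, E j -> t = z j -> y' <> h (z j, x j)).
  apply: filterS => y' Zy' [j Ej jy'].
  exact: (Zy' (z j) (EZ j Ej) j Ej).
apply: Zcov => t Zt.
pose D := [set j | E j /\ x j <> g (t, y)].
have nD : nbhs (t, y) (g @^-1` (~` (x @` D))).
  apply: gc; apply: open_nbhs_nbhs; split; last by move=> [j [_ +]].
  by apply: closed_openC; apply: xcl => j [].
have nE : \forall y' \near y,
    forall j, E j -> x j = g (t, y) -> y' <> h (z j, x j).
  have [[i [Ei xi]]|ni] :=
    pselect (exists i, E i /\ x i = g (t, y)); last first.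
    by apply: nearW => y' j Ej xj; case: ni; exists j.
  have : nbhs y (~` [set h (z i, x i)]).
    apply: open_nbhs_nbhs; split.
      exact/closed_openC/accessible_closed_set1.
    by move=> yi; apply: Yy; exists i.
  apply: filterS => y' ny' j Ej xj.
  by have -> : j = i by [apply: xinj => //; rewrite xj xi].
case: nD => -[V W] [/= tV yW] VW.
exists (V, W `&` [set y' | forall j, E j -> x j = g (t, y) ->
    y' <> h (z j, x j)]); first by split=> //; apply: filterI.
move=> [t' y'] [/= Vt [Wy Ey]] j Ej tj yj.
have [xj|xj] := pselect (x j = g (t, y)); first exact: (Ey j Ej xj).
by apply: (VW (t', y')) => //=; exists j => //; rewrite tj yj gK.
Qed.

(** * Point-discrete families along a convergent sequence *)

(** Infinitely many members that [z] visits infinitely often allow a selection of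
points [z (k n)] with [n <= k n]; they accumulate at [v], so [v] belongs
to the closed set of selected points and is not isolated in it. *)
Lemma point_discrete_finite_frequent (G : topologicalType) (P : set (set G))
    (z : nat -> G) (v : G) :
  point_discrete P -> z @ \oo --> v -> (forall k, z k <> v) ->
  finite_set [set B | P B /\ infinite_set [set k | B (z k)]].
Proof.
move=> Pdisc zv zNv; set F := (X in finite_set X); apply: contrapT => Finf.
have [b [Fb binj]] := nat_distinct_representatives (fun=> Finf).
have /choice[k kP] : forall n, exists k, b n (z k) /\ (n <= k)%N.
  move=> n; have [k bk nk] := infinite_nat_unbounded n (Fb n).2.
  by exists k.
have /choice[x xP] : forall B : set G, exists y,
    (forall n, B = b n -> y = z (k n)) /\ (B !=set0 -> B y).
  move=> B; have [[n Bn]|nB] := pselect (exists n, B = b n).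
    exists (z (k n)); split=> [m|_]; first by rewrite Bn => /binj ->.
    by rewrite Bn; exact: (kP n).1.
  have [[y By]|B0] := pselect (B !=set0).
    by exists y; split=> // n Bn; case: nB; exists n.
  by exists v; split=> // n Bn; case: nB; exists n.
have [] := Pdisc x (fun B _ => (xP B).2).
set A := [set x B | B in _] => Acl Aiso.
have Az n : A (z (k n)).
  exists (b n); last exact: (xP (b n)).1.
  by split; [exact: (Fb n).1 | exists (z (k n)); exact: (kP n).1].
have Vz V : nbhs v V -> exists n, V (z (k n)).
  by move=> /zv[N _ NV]; exists N; apply: NV; exact: (kP N).2.
have Av : A v by apply: Acl => V /Vz[n Vn]; exists (z (k n)).
have [_ [V /Vz[n Vn] VA]] : isolated A v by rewrite Aiso.
apply: (zNv (k n)); suff : (V `&` A) (z (k n)) by rewrite VA.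
by split.
Qed.

(** * Translating a fan along one of its rays *)

Section fan_in_rectifiable_space.
Variables (G : topologicalType) (I : choiceType) (ray : I -> opc_nat -> G).
Variables (h g : G * G -> G) (v : G) (a0 : I).
Hypotheses (rayF : fan ray) (h_cont : continuous h).
Hypotheses (v_def : forall a, ray a None = v) (hv : forall t, h (t, v) = t).
Hypothesis (gK : forall t y, g (t, h (t, y)) = y).

Let Z := range (ray a0).
Let z k := ray a0 (Some k).

Definition fan_translates (a : I) : set G :=
  h @` (Z `*` range (ray a)).

(** Points of [Z] do not count: a point of [Z] can lie on a translate of every
ray, for instance as the vertex of that translate. *)
Definition rays_met (B : set G) : set I :=
  [set a | exists k m, B (h (z k, ray a (Some m))) /\
                       ~ Z (h (z k, ray a (Some m)))].

Lemma ray_compact a : compact (range (ray a)).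
Proof.
apply: continuous_compact; last exact: one_point_compactification_compact.
exact/continuous_subspaceT/(ray_continuous rayF).
Qed.

Lemma fan_translates_compact a : compact (fan_translates a).
Proof.
apply: continuous_compact; last by apply: compact_setX; exact: ray_compact.
exact: continuous_subspaceT.
Qed.

Lemma ray_cvg a : (fun m => ray a (Some m)) @ \oo --> v.
Proof.
rewrite -(v_def a).
apply: (@cvg_comp _ _ _ Some (ray a) \oo (nbhs (None : opc_nat))).
  exact: opc_nat_cvg.
exact: (ray_continuous rayF).
Qed.

(** The translate [h (z k, ray a _)] converges to [z k].  Its late points avoid
the members of [F] that miss [z k], because these are finitely many closed sets,
and they avoid the rest of [Z], because [z k] is isolated in [Z]. *)
Lemma cover_near_vertex (a : I) (F : set (set G)) (k : nat) :
  finite_set F -> (forall B, F B -> closed B) ->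
  fan_translates a `<=` \bigcup_(B in F) B ->
  exists2 B, F B & B (z k) /\ rays_met B a.
Proof.
move=> Ffin Fcl Fcov.
pose C := \bigcup_(B in [set B | F B /\ ~ B (z k)]) B.
have Ccl : closed C.
  apply: closed_bigcup; last by move=> B [/Fcl Bcl _]; exact: Bcl.
  by apply: sub_finite_set Ffin => B [].
have zkV : nbhs (z k) (~` C `&` ~` (Z `\ z k)).
  apply: open_nbhs_nbhs; split.
    by apply: openI; apply: closed_openC => //; exact: fan_ray_remove_closed.
  by split=> [[B [_ nB] /nB]|[_ /(_ erefl)]].
have hz : (fun m => h (z k, ray a (Some m))) @ \oo --> z k.
  rewrite -[X in _ --> X]hv.
  apply: (@cvg_comp _ _ _ (fun m => (z k, ray a (Some m))) h \oo
    (nbhs (z k, v))); last exact: h_cont.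
  by apply: cvg_pair; [exact: cvg_cst|exact: ray_cvg].
have [N _ /(_ N (leqnn N))[/= nC nZ]] := hz _ zkV.
have [|B FB By] := Fcov (h (z k, ray a (Some N))).
  exists (z k, ray a (Some N)) => //.
  by split; [exists (Some k)|exists (Some N)].
exists B => //; split; first by apply: contrapT => nB; apply: nC; exists B.
exists k, N; split=> // Zy; apply: nZ; split=> // hzk.
(* A late point equal to [z k] would come from the vertex, as [h (z k, _)] is
   injective. *)
have : ray a (Some N) = ray a None.
  by rewrite v_def -(gK (z k) (ray a _)) hzk -[X in g (_, X)]hv gK.
by move/(ray_inj rayF) => [].
Qed.

(** [cover_near_vertex] picks a member of [F] for every [k]; as [F] is finite,
one member is picked infinitely often. *)
Lemma cover_frequent (a : I) (F : set (set G)) :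
  finite_set F -> (forall B, F B -> closed B) ->
  fan_translates a `<=` \bigcup_(B in F) B ->
  exists2 B, F B & infinite_set [set k | B (z k)] /\ rays_met B a.
Proof.
move=> Ffin Fcl Fcov.
have /choice[c cP] : forall k, exists B, F B /\ B (z k) /\ rays_met B a.
  by move=> k; have [B FB BP] := cover_near_vertex k Ffin Fcl Fcov; exists B.
have [B FB Binf] := finite_fiber_infinite Ffin (fun k => (cP k).1).
exists B => //; split.
  by apply: sub_infinite_set Binf => k /= <-; exact: (cP k).2.1.
have [k /= <-] := infinite_setN0 Binf; exact: (cP k).2.2.
Qed.

(** For each of the countably many points [t] of [Z], injectivity of [h (t, _)]
leaves at most one ray whose translate by [t] passes through [y]; the vertex is
excluded, as its translates are in [Z]. *)
Lemma point_countable_translates (y : G) :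
  ~ Z y -> countable [set a | fan_translates a y].
Proof.
move=> nZy.
pose A (o : option nat) := [set a | exists o', h (ray a0 o, ray a o') = y].
apply: (@sub_countable _ _ _ (\bigcup_o A o)).
  apply: subset_card_le => a [[_ _] [/= [o _ <-] [o' _ <-]] hy].
  by exists o => //; exists o'.
apply: bigcup_countable => // o _.
have [->//|/set0P[b [ob hb]]] := eqVneq (A o) set0.
apply: (@sub_countable _ _ _ [set b]) => //.
apply: subset_card_le => a [oa ha].
have : ray a oa = ray b ob.
  by rewrite -(gK (ray a0 o) (ray a oa)) -(gK (ray a0 o) (ray b ob)) ha hb.
case: oa ha => [m _ /(ray_inj rayF)[]//|].
by rewrite v_def hv => oy; case: nZy; exists o.
Qed.

End fan_in_rectifiable_space.

Theorem theorem4p4 (G : topologicalType)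
    (G_T1 : accessible_space G) (G_regular : regular_space G)
    (G_rectifiable : rectifiable G)
    (G_network : has_sigma_point_discrete_closed_k_network G)
    (I : choiceType) (R : rel I) (I_omega1 : order_type_omega1 R) :
  ~ contains_closed_copy G (sequential_fan I).
Proof.
move=> /closed_copy_fan[ray rayF].
have [_ Iunc _] := I_omega1.
have [a0 _] : [set: I] !=set0.
  by apply/set0P; apply: contra_notN Iunc => /eqP ->.
pose v := ray a0 None; pose z k := ray a0 (Some k).
have rayv a : ray a None = v by exact: ray_None.
have [h [g [hc gc hv gK]]] := rectifiable_translations v G_rectifiable.
have [P [Pdisc Pcl Pnet]] := G_network.
pose good := \bigcup_n [set B | P n B /\ infinite_set [set k | B (z k)]].
have good_countable : countable good.
  apply: bigcup_countable => // n _; apply: finite_set_countable.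
  apply: (point_discrete_finite_frequent (Pdisc n) (ray_cvg rayF rayv a0)).
  by move=> k /(ray_inj rayF)[].
pose met := rays_met ray h a0.
(* The good members that the open set of the diagonal argument must not
   contain. *)
pose wide := [set B | good B /\ infinite_set (met B)].
have wide_countable : countable wide.
  by apply: sub_countable good_countable; apply: subset_card_le => B [].
have [al [alP alinj]] : exists al : set G -> I,
    (forall B, wide B -> met B (al B)) /\
    (forall B C, wide B -> wide C -> al B = al C -> B = C).
  have [W0|/set0P W0] := eqVneq wide set0.
    by exists (fun=> a0); split; rewrite W0.
  by apply: countable_distinct_representatives => // B [].
have /choice[km kmP] : forall B, exists km : nat * nat, wide B ->
    let y := h (z km.1, ray (al B) (Some km.2)) in B y /\ ~ range (ray a0) y.
  move=> B; have [WB|nWB] := pselect (wide B); last by exists (0, 0)%N.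
  by have [k [m ?]] := alP B WB; exists (k, m).
pose y B := h (z (km B).1, ray (al B) (Some (km B).2)).
have Ycl : closed (y @` wide).
  apply: (closed_translates (E := wide) (z := fun B => z (km B).1)
    (x := fun B => ray (al B) (Some (km B).2)) G_T1 gc gK
    (ray_compact rayF (a := a0))).
  - by move=> B _; exists (Some (km B).1).
  - by move=> B C WB WC /(ray_inj rayF)[/alinj alBC _]; exact: alBC.
  move=> D DW; apply: (fan_transversal_closed rayF) => B C /DW WB /DW WC.
  exact: alinj.
(* The rays for which the argument fails: those with a translate through some
   [y B], and those met by a good member that meets finitely many rays. *)
pose bad := \bigcup_(B in wide) [set a | fan_translates ray h a0 a (y B)] `|`
  \bigcup_(B in good `\` wide) met B.
have [a _ nbad] : exists2 a, [set: I] a & ~ bad a.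
  apply: contrapT => nb; apply: Iunc.
  apply: (@sub_countable _ _ _ bad).
    apply: subset_card_le => a _; apply: contrapT => na.
    by apply: nb; exists a.
  rewrite /bad -bigcup2E; apply: bigcup_countable => // -[|[|//]] _ /=.
    apply: bigcup_countable => // B WB.
    exact: (point_countable_translates rayF rayv hv gK (kmP B WB).2).
  apply: bigcup_countable => [|B [gB nWB]].
    by apply: sub_countable good_countable; apply: subset_card_le => B [].
  apply: finite_set_countable; apply: contrapT => minf.
  by apply: nWB; split.
have Ka := fan_translates_compact rayF hc (a := a) (a0 := a0).
have [||F [Ffin FP Fcov FU]] := Pnet _ (~` (y @` wide)) Ka.
- exact: closed_openC.
- by move=> x Kx [B WB yx]; apply: nbad; left; exists B => //=; rewrite yx.
have Fcl B : F B -> closed B by move=> /FP[n _]; exact: Pcl.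
have [B FB [Binf Ba]] := cover_frequent rayF hc rayv hv gK Ffin Fcl Fcov.
have gB : good B by have [n _ PB] := FP _ FB; exists n.
have [WB|nWB] := pselect (wide B); last by apply: nbad; right; exists B.
by apply: (FU (y B)); [exists B => //; exact: (kmP B WB).1|exists B].
Qed.
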